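(* Let $\mathcal{D}$ be a probability distribution, and for each $\xi\sim\mathcal{D}$ let $f_\xi:\mathbb{R}^d\to\mathbb{R}$ be differentiable and $\mu$-strongly convex with a common constant $\mu>0$, i.e. $f_\xi(y)+\langle\nabla f_\xi(y),x-y\rangle+\frac{\mu}{2}\|x-y\|^2\le f_\xi(x)$ for all $x,y\in\mathbb{R}^d$. Let $f(x)=\mathbb{E}_{\xi\sim\mathcal{D}}[f_\xi(x)]$ and let $x_\star$ be its unique minimizer. Let $\{x_k,\phi_k,h_k\}$ be produced by SPPM-LC (see context) and suppose the $\sigma_k^2$-assumption (see context) holds with function $\sigma^2:\mathbb{R}^m\to\mathbb{R}_+$ and constants $A_1,B_1,C_1,A_2,B_2,C_2\ge 0$, $B_2<1$. Choose any $\gamma>0$ and $\alpha>0$ satisfying $$\frac{(1+\gamma^2A_1)(1+\alpha A_2)}{(1+\gamma\mu)^2}<1,\qquad \frac{\gamma^2B_1(1+\alpha A_2)}{\alpha(1+\gamma\mu)^2}+B_2<1,$$ and define $\Psi_k:=\|x_k-x_\star\|^2+\alpha\sigma_k^2$, where $\sigma_k^2=\sigma^2(\phi_k)$. Then for all $k\ge 0$, $$\mathbb{E}[\Psi_k]\le\theta^k\Psi_0+\frac{\zeta}{1-\theta},$$ where $$\theta=\max\left\{\frac{(1+\gamma^2A_1)(1+\alpha A_2)}{(1+\gamma\mu)^2},\ \frac{\gamma^2B_1(1+\alpha A_2)}{\alpha(1+\gamma\mu)^2}+B_2\right\}\in[0,1),\qquad \zeta=\frac{\gamma^2C_1(1+\alpha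 A_2)}{(1+\gamma\mu)^2}+\alpha C_2\ge 0.$$
   Context: Notation: $\operatorname{prox}_{\gamma\phi}(y):=\arg\min_{x\in\mathbb{R}^d}\{\phi(x)+\frac{1}{2\gamma}\|x-y\|^2\}$. It is assumed that differentiation and expectation can be interchanged, so $\nabla f(x)=\mathbb{E}_{\xi\sim\mathcal{D}}[\nabla f_\xi(x)]$. Algorithm SPPM-LC (Stochastic Proximal Point Method with Learned Correction): parameters $\gamma>0$, starting point $x_0\in\mathbb{R}^d$, control vector $\phi_0\in\mathbb{R}^m$. For $k=0,1,2,\dots$: sample $\xi_k\sim\mathcal{D}$ (independently of the past); form a correction vector $h_k\in\mathbb{R}^d$ as a function of $x_k$, $\phi_k$ and $\xi_k$; set $x_{k+1}=\operatorname{prox}_{\gamma f_{\xi_k}}(x_k+\gamma h_k)$; construct a new (possibly random) control vector $\phi_{k+1}\in\mathbb{R}^m$. $\sigma_k^2$-assumption: there exist a function $\sigma^2:\mathbb{R}^m\to\mathbb{R}_+$ and nonnegative constants $A_1,B_1,C_1,A_2,B_2,C_2$ with $B_2<1$ such that, writing $\sigma_k^2:=\sigma^2(\phi_k)$, for all $k\ge0$: (i) $\mathbb{E}[h_k\mid x_k,\phi_k]=0$; (ii) $\mathbb{E}[\|h_k-\nabla f_{\xi_k}(x_\star)\|^2\mid x_k,\phi_k]\le A_1\|x_k-x_\star\|^2+B_1\sigma_k^2+C_1$; (iii) $\mathbb{E}[\sigma_{k+1}^2\mid x_{k+1},\phi_k]\le A_2\|x_{k+1}-x_\star\|^2+B_2\sigma_k^2+C_2$.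 *)

(* Defs.v *)
From HB Require Import structures.
From mathcomp Require Import all_boot all_order all_algebra.
From mathcomp Require Import all_classical all_reals all_analysis.
Set Implicit Arguments. Unset Strict Implicit. Unset Printing Implicit Defensive.
Import Order.TTheory GRing.Theory Num.Theory.
Import numFieldNormedType.Exports.
Local Open Scope classical_set_scope.
Local Open Scope ring_scope.

(* Vectors of R^n are row vectors 'rV[R]_n; the Euclidean structure is
   defined explicitly (the library norm on matrices is the max norm). *)
Definition dotv (R : realType) (n : nat) (u v : 'rV[R]_n) : R :=
  \sum_(i < n) u 0 i * v 0 i.
Definition sqn (R : realType) (n : nat) (v : 'rV[R]_n) : R := dotv v v.

Definition grad (R : realType) (n : nat) (g : 'rV[R]_n -> R) (x : 'rV[R]_n)
  : 'rV[R]_n := \row_(i < n) ('d g x (delta_mx 0 i : 'rV[R]_n)).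

Definition is_prox (R : realType) (n : nat) (gam : R) (phi : 'rV[R]_n -> R)
  (y p : 'rV[R]_n) : Prop :=
  forall z, phi p + sqn (p - y) / (2 * gam) <= phi z + sqn (z - y) / (2 * gam).

(* events generated by a random vector X : Omega -> R^n (Borel sigma-algebra
   of R^n = product sigma-algebra, generated by the coordinates) *)
Definition vec_events (d : measure_display) (T : measurableType d)
  (R : realType) (n : nat) (X : T -> 'rV[R]_n) : set (set T) :=
  [set E | exists (i : 'I_n) (A : set R), measurable A /\
            E = (fun w => X w 0 i) @^-1` A].

Definition rv_events (d : measure_display) (T : measurableType d)
  (d' : measure_display) (U : measurableType d') (Y : T -> U) : set (set T) :=
  [set E | exists A : set U, measurable A /\ E = Y @^-1` A].

Definition vec_measurable (d : measure_display) (T : measurableType d)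
  (R : realType) (n : nat) (X : T -> 'rV[R]_n) : Prop :=
  forall i : 'I_n, measurable_fun setT (fun w => X w 0 i).

Definition past_events (d : measure_display) (T : measurableType d)
  (R : realType) (n m : nat) (dX : measure_display) (X : measurableType dX)
  (x : nat -> T -> 'rV[R]_n) (phi : nat -> T -> 'rV[R]_m) (xi : nat -> T -> X)
  (k : nat) : set (set T) :=
  [set E | (exists j, (j <= k)%N /\ (vec_events (x j) E \/ vec_events (phi j) E))
        \/ (exists j, (j < k)%N /\ rv_events (xi j) E)].

(* Main.v *)
Require Import Defs.
From HB Require Import structures.
From mathcomp Require Import all_boot all_order all_algebra.
From mathcomp Require Import all_classical all_reals all_analysis.
From mathcomp Require Import measurable_realfun.
From mathcomp Require Import ring lra.
Import Order.TTheory GRing.Theory Num.Theory.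
Import numFieldNormedType.Exports.
Local Open Scope classical_set_scope.
Local Open Scope ring_scope.

(* The proximal map of a mu-strongly convex function is a contraction with
   factor 1 / (1 + gam mu), and xstar is its value at
   xstar + gam grad f_xi(xstar); hence (1 + gam mu)^2 |x_{k+1} - xstar|^2 is at
   most |x_k - xstar + gam (h_k - grad f_{xi_k}(xstar))|^2.  Conditionally on
   x_k the vector h_k - grad f_{xi_k}(xstar) is centred, since h_k is and
   E grad f_xi(xstar) = grad f(xstar) = 0 with xi_k independent of x_k.  The
   cross term therefore vanishes in expectation, and the sigma_k^2-assumption
   yields E Psi_{k+1} <= theta E Psi_k + zeta. *)

Set Implicit Arguments.
Unset Strict Implicit.

(** * Algebra of the Euclidean inner product *)

Lemma dotvC (R : realType) (n : nat) (u v : 'rV[R]_n) : dotv u v = dotv v u.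
Proof. by apply: eq_bigr => i _; rewrite mulrC. Qed.

Lemma dotvDr (R : realType) (n : nat) (u v w : 'rV[R]_n) :
  dotv u (v + w) = dotv u v + dotv u w.
Proof. by rewrite -big_split; apply: eq_bigr => i _; rewrite mxE mulrDr. Qed.

Lemma dotvZr (R : realType) (n : nat) (u v : 'rV[R]_n) (a : R) :
  dotv u (a *: v) = a * dotv u v.
Proof. by rewrite mulr_sumr; apply: eq_bigr => i _; rewrite mxE mulrCA. Qed.

Lemma sqnZ (R : realType) (n : nat) (u : 'rV[R]_n) (a : R) :
  sqn (a *: u) = a ^+ 2 * sqn u.
Proof. by rewrite /sqn dotvZr dotvC dotvZr mulrA. Qed.

Lemma sqn_ge0 (R : realType) (n : nat) (u : 'rV[R]_n) : 0 <= sqn u.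
Proof. by apply: sumr_ge0 => i _; rewrite -expr2 sqr_ge0. Qed.

Lemma sqnDZ (R : realType) (n : nat) (u v : 'rV[R]_n) (a : R) :
  sqn (u + a *: v) = sqn u + 2 * a * dotv u v + a ^+ 2 * sqn v.
Proof.
rewrite -mulrA -dotvZr -sqnZ /sqn dotvDr ![dotv (u + _) _]dotvC !dotvDr.
by rewrite (dotvC (a *: v) u); ring.
Qed.

(** Replaces the limit t -> 0: if b < a, then t = 1 (for c <= 0) or t = (a - b) / (2 (c + a - b))
    (for c > 0) makes t c < a - b, a contradiction. *)
Lemma le_of_le_add_small (R : realFieldType) (a b c : R) :
  (forall t, 0 < t <= 1 -> a <= b + t * c) -> a <= b.
Proof.
move=> abc; apply: contraT; rewrite -ltNge => ba.
have [c0|c0] := leP c 0.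
  have := abc 1; rewrite ltr01 lexx mul1r => /(_ isT); lra.
have d0 : 0 < c + (a - b) by lra.
have := abc ((a - b) / (2 * (c + (a - b)))).
have -> : 0 < (a - b) / (2 * (c + (a - b))) <= 1.
  rewrite divr_gt0 ?ler_pdivrMr ?mulr_gt0 ?subr_gt0//=; lra.
move=> /(_ isT).
suff : (a - b) / (2 * (c + (a - b))) * c < a - b by lra.
by rewrite mulrAC ltr_pdivrMr ?mulr_gt0//; nra.
Qed.

(** * Proximal points of a strongly convex function *)

Section prox.
Context {R : realType} {n : nat}.
Variables (f : 'rV[R]_n -> R) (g : 'rV[R]_n -> 'rV[R]_n) (mu gam : R).
Hypothesis gam_gt0 : 0 < gam.
Hypothesis f_convex : forall u y,
  f y + dotv (g y) (u - y) + mu / 2 * sqn (u - y) <= f u.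

(** Add the gradient inequalities based at z = p + t v, towards p with weight 1 - t and towards p +
    v with weight t. The gradient terms cancel, and the quadratic ones add up because (1 - t) t^2 +
    t (1 - t)^2 = t (1 - t). *)
Lemma strongly_convex_segment (p v : 'rV[R]_n) (t : R) : 0 <= t <= 1 ->
  f (p + t *: v) + mu / 2 * (t * (1 - t)) * sqn v
    <= (1 - t) * f p + t * f (p + v).
Proof.
move=> /andP[t0 t1].
set z := p + t *: v.
have pz : p - z = (- t) *: v by rewrite /z opprD addrA subrr add0r scaleNr.
have qz : p + v - z = (1 - t) *: v.
  by rewrite /z scalerBl scale1r opprD addrACA subrr add0r.
have := f_convex p z; have := f_convex (p + v) z.
by rewrite pz qz !sqnZ !dotvZr => q1 p1; nra.
Qed.

(* Compare the values at p and p + t v, divide by t and let t tend to 0: this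
   avoids differentiating f at the proximal point. *)
Lemma prox_optimality (y p v : 'rV[R]_n) : is_prox gam f y p ->
  f p + mu / 2 * sqn v <= f (p + v) + dotv (p - y) v / gam.
Proof.
move=> prox_p.
(* The slack of order t has two sources: [mu / 2] from the factor 1 - t on the segment, and
   [(2 * gam)^-1] from the square in the proximal objective. *)
apply: (@le_of_le_add_small _ _ _ ((mu / 2 + (2 * gam)^-1) * sqn v)) => t t01.
have /andP[t0 t1] := t01.
have := @strongly_convex_segment p v t; rewrite (ltW t0) t1 => /(_ isT).
have := prox_p (p + t *: v); rewrite addrAC sqnDZ.
have -> : (sqn (p - y) + 2 * t * dotv (p - y) v + t ^+ 2 * sqn v) / (2 * gam)
  = sqn (p - y) / (2 * gam) + t * (dotv (p - y) v / gam)
    + t ^+ 2 * ((2 * gam)^-1 * sqn v) by field; exact: lt0r_neq0.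
set a := sqn (p - y) / _; set b := dotv _ v / _; set c := (2 * gam)^-1.
move=> h1 h2; rewrite -(ler_pM2l t0).
idtac. nra.
Qed.

(** With u = p - q and w = y - q - gam g(q), the optimality of p tested at q plus the gradient
    inequality at q tested at p give (1 + gam mu) |u|^2 <= <u, w>. Expanding |w - (1 + gam mu) u|^2
    >= 0 then bounds |w|^2 from below. *)
Lemma prox_contraction (y p q : 'rV[R]_n) : 0 < mu -> is_prox gam f y p ->
  (1 + gam * mu) ^+ 2 * sqn (p - q) <= sqn (y - q - gam *: g q).
Proof.
move=> mu0 prox_p.
pose u := p - q; pose w := y - q - gam *: g q.
have pqE : q - p = -1 *: u by rewrite scaleN1r opprB.
have dotE : dotv (p - y) (q - p) = dotv u w + gam * dotv (g q) u - sqn u.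
  have pyE : p - y = u + -1 *: (w + gam *: g q).
    by apply/rowP => i; rewrite !mxE; ring.
  rewrite pqE pyE; clear pqE pyE; clearbody u w.
  by rewrite dotvZr dotvC !(dotvDr, dotvZr) (dotvC u (g q)) /sqn; ring.
have fp : (f p + mu / 2 * sqn u) * gam
    <= f q * gam + (dotv u w + gam * dotv (g q) u - sqn u).
  have := prox_optimality (q - p) prox_p; rewrite [p + _]addrC subrK dotE.
  rewrite -(ler_pM2r gam_gt0) [leRHS]mulrDl divfK ?gt_eqF// pqE sqnZ.
  by rewrite sqrrN expr1n mul1r.
have fq : (f q + dotv (g q) u + mu / 2 * sqn u) * gam <= f p * gam.
  by rewrite ler_pM2r//; exact: f_convex.
have := sqn_ge0 (w + - (1 + gam * mu) *: u); rewrite sqnDZ (dotvC w) -/w => w_ge0.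
have : (1 + gam * mu) * sqn u <= dotv u w by lra.
have : 0 < 1 + gam * mu by rewrite addr_gt0 ?mulr_gt0.
nra.
Qed.
End prox.

(** Fermat's rule along each coordinate line through p: the restriction [g] has an interior minimum
    at 0 on ]-1, 1[, and its derivative there is the partial derivative of f at p. *)
Lemma grad_at_min (R : realType) (n : nat) (f : 'rV[R]_n -> R) (p : 'rV[R]_n) :
  (forall u, differentiable f u) -> (forall u, f p <= f u) -> grad f p = 0.
Proof.
move=> df fp; apply/rowP => i; rewrite !mxE -deriveE//.
set v : 'rV[R]_n := delta_mx 0 i.
pose g (t : R) := f (t *: v + p).
have dg t : derivable g t 1.
  apply/derivable1_diffP.
  apply: (@differentiable_comp _ _ _ _ (fun t : R => t *: v + p) f) => //.
have -> : 'D_v f p = 'D_1 g 0.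
  rewrite /derive.
  suff -> : (fun t : R => t^-1 *: ((f \o shift p) (t *: v) - f p))
    = (fun t => t^-1 *: ((g \o shift 0) (t *: 1) - g 0)) by [].
  apply/funext => t /=.
  by rewrite /g scale0r !add0r addr0 -[t *: 1]/(t * 1) mulr1.
apply: derive_val; apply: (@derive1_at_min _ g (-1) 1) => // [|t _].
  by rewrite in_itv/= ltrN10 ltr01.
by rewrite /g scale0r add0r.
Qed.

(** * Functions of X are orthogonal to variables centred given X *)

Section orthogonality.
Context {d : measure_display} {T : measurableType d} {R : realType}.
Variable P : {measure set T -> \bar R}.
Context {d' : measure_display} {U : measurableType d'}.
Import HBNNSimple.

(** A simple [s] takes finitely many values r, so s(X) Z is a finite sum of r Z restricted to the
    events [A r], on each of which Z integrates to 0. *)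
Lemma integral_mul_nnsfun0 (s : {nnsfun U >-> R}) (X : T -> U) (Z : T -> R) :
  measurable_fun setT X -> P.-integrable setT (EFin \o Z) ->
  (forall A : set U, measurable A -> \int[P]_(w in X @^-1` A) (Z w)%:E = 0)%E ->
  (\int[P]_w (s (X w) * Z w)%:E = 0)%E.
Proof.
move=> mX iZ Z0.
pose A r := X @^-1` (s @^-1` [set r]).
have ms r : measurable (s @^-1` [set r]).
  exact: (measurable_funPTI s (measurable_set1 r)).
have mA r : measurable (A r) by rewrite -[A r]setTI; exact: mX.
pose F (r : R) (w : T) : \bar R := (r%:E * ((EFin \o Z) \_ (A r)) w)%E.
have iZA r : P.-integrable setT ((EFin \o Z) \_ (A r)).
  by apply/(integrable_mkcond _ (mA r)); apply: (@integrableS _ _ _ _ setT).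
transitivity (\int[P]_w (\sum_(r <- finmap.enum_fset (fset_set (range s))) F r w))%E.
  apply: eq_integral => w _; rewrite fimfunE fsbig_finite//= mulr_suml -sumEFin//.
  apply: eq_bigr => r _; rewrite /F epatch_indic/= -!EFinM; congr EFin.
  rewrite mulrAC -mulrA; congr (_ * (_ * _)).
rewrite integral_sum//= => [|r]; last exact: integrableZl.
rewrite big1 => [//|r _].
by rewrite integralZl// -integral_mkcond Z0 ?mule0.
Qed.

(** Simple functions increasing to g reduce this to the previous case; dominated convergence applies
    with bound |g(X) Z|. *)
Lemma integral_mul_ge0_comp0 (g : U -> R) (X : T -> U) (Z : T -> R) :
  measurable_fun setT g -> (forall r, 0 <= g r) ->
  measurable_fun setT X -> P.-integrable setT (EFin \o Z) ->
  P.-integrable setT (fun w => (g (X w) * Z w)%:E) ->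
  (forall A : set U, measurable A -> \int[P]_(w in X @^-1` A) (Z w)%:E = 0)%E ->
  (\int[P]_w (g (X w) * Z w)%:E = 0)%E.
Proof.
move=> mg g_ge0 mX iZ igXZ Z0.
have mEg := (measurable_EFinP setT g).2 mg.
pose s n := nnsfun_approx measurableT mEg n.
have mZ : measurable_fun setT Z by apply/measurable_EFinP; exact: measurable_int iZ.
have cvg_s r : (EFin \o s^~ r) @ \oo --> (g r)%:E.
  by apply: (cvg_nnsfun_approx measurableT mEg) => // ? _; rewrite lee_fin.
have le_s n r : s n r <= g r.
  rewrite -lee_fin /s nnsfun_approxE.
  by apply: le_approx => // ? _; rewrite lee_fin.
have [| | | | |_ _] := @dominated_convergence _ _ _ P _ measurableT
  (fun n w => (s n (X w) * Z w)%:E) (fun w => (g (X w) * Z w)%:E)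
  (fun w => `|(g (X w) * Z w)%:E|%E).
- move=> n; apply/measurable_EFinP; apply: measurable_funM => //.
  exact: measurableT_comp.
- exact: measurable_int igXZ.
- apply/aeW => w _; under eq_fun do rewrite EFinM.
  by rewrite EFinM; apply: cvgeZr => //; exact: cvg_s.
- exact: integrable_abse.
- apply/aeW => w n _; rewrite lee_fin !normrM ler_wpM2r//.
  by rewrite !ger0_norm ?le_s.
- under eq_fun do rewrite integral_mul_nnsfun0//.
  by move=> /(cvg_unique (@ereal_hausdorff R)); apply; exact: cvg_cst.
Qed.

(* E[g(X) Z] = 0 when E[Z | X] = 0. *)
Lemma integral_mul_comp0 (g : U -> R) (X : T -> U) (Z : T -> R) :
  measurable_fun setT g -> measurable_fun setT X ->
  P.-integrable setT (EFin \o Z) ->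
  P.-integrable setT (fun w => (g (X w) * Z w)%:E) ->
  (forall A : set U, measurable A -> \int[P]_(w in X @^-1` A) (Z w)%:E = 0)%E ->
  (\int[P]_w (g (X w) * Z w)%:E = 0)%E.
Proof.
move=> mg mX iZ igXZ Z0.
have mZ : measurable_fun setT Z by apply/measurable_EFinP; exact: measurable_int iZ.
(* The positive and negative parts of g lie below |g|, so their products with Z inherit
   integrability. *)
have gXZ (k : U -> R) : measurable_fun setT k ->
    (forall r, `|k r| <= `|g r|) ->
    P.-integrable setT (fun w => (k (X w) * Z w)%:E).
  move=> mk k_le; apply: le_integrable igXZ => //.
    apply/measurable_EFinP; apply: measurable_funM => //.
    exact: measurableT_comp.
  by move=> w _; rewrite lee_fin !normrM ler_wpM2r.
have I0 (k : U -> R) : measurable_fun setT k ->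
    (forall r, `|k r| <= `|g r|) -> (forall r, 0 <= k r) ->
    (\int[P]_w (k (X w) * Z w)%:E = 0)%E.
  by move=> mk k_le k_ge0; apply: integral_mul_ge0_comp0 => //; exact: gXZ.
have mp := measurable_funrpos mg; have mn := measurable_funrneg mg.
have p_le r : `|g^\+ r| <= `|g r|.
  by rewrite /funrpos/=; case: (leP (g r) 0) => // _; rewrite normr0.
have n_le r : `|g^\- r| <= `|g r|.
  rewrite /funrneg/=; case: (leP (- g r) 0) => // _; rewrite ?normr0//.
  by rewrite normrN.
have gE w : (g (X w) * Z w)%:E
    = ((g^\+ (X w) * Z w)%:E - (g^\- (X w) * Z w)%:E)%E.
  by rewrite -EFinB -mulrBl -[in LHS](funrposBneg g).
under eq_integral do rewrite gE.
rewrite integralB//; [|exact: gXZ|exact: gXZ].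
rewrite (I0 _ mp p_le (funrpos_ge0 g)) (I0 _ mn n_le (funrneg_ge0 g)).
by rewrite sube0.
Qed.
End orthogonality.

(** * Transfer of integrals to the law, and factorization under independence *)

Section independence.
Context {d d' : measure_display} {T : measurableType d} {U : measurableType d'}.
Context {R : realType} (P : probability T R) (D : probability U R).
Variables (X : T -> U) (g : U -> R).
Hypothesis mX : measurable_fun setT X.
Hypothesis lawX : forall A, measurable A -> P (X @^-1` A) = D A.
Hypothesis ig : D.-integrable setT (EFin \o g).

Lemma integrable_law : P.-integrable setT (fun w => (g (X w))%:E).
Proof.
have [mg goo] := integrableP _ _ _ ig; apply/integrableP; split.
  exact: (measurableT_comp mg).
suff -> : (\int[P]_w `|(g (X w))%:E| = \int[D]_z `|(g z)%:E|)%E by [].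
rewrite -(@eq_measure_integral _ _ _ _ _ (pushforward P X)).
  rewrite ge0_integral_pushforward//.
  exact: measurableT_comp.
by move=> A mA _; exact: lawX.
Qed.

Lemma integral_law : (\int[P]_w (g (X w))%:E = \int[D]_z (g z)%:E)%E.
Proof.
rewrite -(@eq_measure_integral _ _ _ _ _ (pushforward P X)).
  rewrite integral_pushforward//; last exact: integrable_law.
  exact: measurable_int ig.
by move=> A mA _; exact: lawX.
Qed.

Lemma integral_independent (E : set T) : measurable E ->
  (forall A, measurable A -> P (X @^-1` A `&` E) = (P (X @^-1` A) * P E)%E) ->
  (\int[P]_(w in E) (g (X w))%:E = P E * \int[D]_z (g z)%:E)%E.
Proof.
move=> mE indep.
have mg : measurable_fun setT g by apply/measurable_EFinP; exact: measurable_int ig.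
(* Independence means that 1_E - P E is centred conditionally on X. *)
have PE_fin : P E \is a fin_num by exact: fin_num_measure.
pose Z w : R := \1_E w - fine (P E).
have i1 : P.-integrable setT (fun w => (\1_E w : R)%:E) by exact: integrable_indic.
have ic : P.-integrable setT (fun w => (fine (P E))%:E).
  exact: finite_measure_integrable_cst.
have iZ : P.-integrable setT (EFin \o Z) by exact: (integrableB measurableT i1 ic).
have igX := integrable_law.
have ig1 : P.-integrable setT (fun w => (g (X w) * \1_E w)%:E).
  apply: le_integrable igX => //.
    apply/measurable_EFinP; apply: measurable_funM => //.
    exact: measurableT_comp.
  move=> w _; rewrite lee_fin normrM indicE; case: (w \in E).
    by rewrite normr1 mulr1.
  by rewrite normr0 mulr0.
have igc : P.-integrable setT (fun w => ((fine (P E))%:E * (g (X w))%:E)%E).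
  exact: integrableZl.
have gZE w : (g (X w) * Z w)%:E
    = ((g (X w) * \1_E w)%:E - (fine (P E))%:E * (g (X w))%:E)%E.
  by rewrite -EFinM -EFinB /Z mulrBr [fine _ * _]mulrC.
have igZ : P.-integrable setT (fun w => (g (X w) * Z w)%:E).
  by under eq_fun do rewrite gZE; exact: (integrableB measurableT ig1 igc).
have mXA A : measurable A -> measurable (X @^-1` A).
  by move=> mA; rewrite -[X in measurable X]setTI; exact: mX.
have gZ0 : (\int[P]_w (g (X w) * Z w)%:E = 0)%E.
  apply: integral_mul_comp0 => // A mA.
  have mA' := mXA _ mA.
  under eq_integral do rewrite /Z EFinB.
  rewrite integralB//; [|exact: integrableS i1|exact: integrableS ic].
  rewrite integral_indic// integral_cst//.
  rewrite fineK//; have /= := indep _ mA; rewrite setIC => ->.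
  by rewrite muleC subee// fin_numM//?fin_num_measure.
have -> : (\int[P]_(w in E) (g (X w))%:E = \int[P]_w (g (X w) * \1_E w)%:E)%E.
  rewrite integral_mkcond; apply: eq_integral => w _.
  by rewrite epatch_indic.
(* Expanding E[g(X) (1_E - P E)] = 0 yields E[g(X) 1_E] = P E * E[g(X)]. *)
move: gZ0; under eq_integral do rewrite gZE.
rewrite integralB// integralZl// integral_law fineK// => /eqP.
rewrite sube_eq ?add0e => [/eqP //||].
- exact: integrable_fin_num ig1.
- by rewrite fin_num_adde_defl// fin_numM//; exact: integrable_fin_num ig.
Qed.
End independence.

(** * Second moments of random vectors *)

Section second_moments.
Context {d : measure_display} {T : measurableType d} {R : realType}.
Variable P : {measure set T -> \bar R}.

Lemma ge0_integrable_lty (f : T -> R) :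
  measurable_fun setT f -> (forall w, 0 <= f w) ->
  (\int[P]_w (f w)%:E < +oo)%E -> P.-integrable setT (fun w => (f w)%:E).
Proof.
move=> mf f_ge0 foo; apply/integrableP; split; first exact/measurable_EFinP.
by under eq_integral do rewrite gee0_abs ?lee_fin//.
Qed.

Lemma measurable_sqn (n : nat) (V : T -> 'rV[R]_n) :
  vec_measurable V -> measurable_fun setT (fun w => sqn (V w)).
Proof.
by move=> mV; apply: measurable_sum => i; apply: measurable_funM; exact: mV.
Qed.

Context {n : nat}.
Variables U V : T -> 'rV[R]_n.
Hypotheses (mU : vec_measurable U) (mV : vec_measurable V).
Hypothesis iU : P.-integrable setT (fun w => (sqn (U w))%:E).
Hypothesis iV : P.-integrable setT (fun w => (sqn (V w))%:E).
Hypothesis iVi : forall i, P.-integrable setT (fun w => (V w 0 i)%:E).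
Hypothesis V_orth : forall (i : 'I_n) (A : set R), measurable A ->
  (\int[P]_(w in (fun w => U w 0%R i) @^-1` A) (V w 0 i)%:E = 0)%E.

Lemma sqr_le_sqn (v : 'rV[R]_n) i : v 0 i ^+ 2 <= sqn v.
Proof.
rewrite /sqn /dotv (bigD1 i)//= -expr2 lerDl sumr_ge0// => j _.
by rewrite -expr2 sqr_ge0.
Qed.

(** Each product is dominated by |U|^2 + |V|^2, through (|U_i| - |V_i|)^2 >= 0. *)
Let iUV i : P.-integrable setT (fun w => (U w 0 i * V w 0 i)%:E).
Proof.
have iS : P.-integrable setT (fun w => ((sqn (U w))%:E + (sqn (V w))%:E)%E).
  exact: (integrableD measurableT iU iV).
apply: le_integrable iS => //.
  by apply/measurable_EFinP; apply: measurable_funM; [exact: mU|exact: mV].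
move=> w _; rewrite -EFinD lee_fin normrM [leRHS]ger0_norm ?addr_ge0 ?sqn_ge0//.
have := sqr_le_sqn (U w) i; have := sqr_le_sqn (V w) i.
rewrite -(real_normK (num_real (U w 0 i))) -(real_normK (num_real (V w 0 i))).
by have := sqr_ge0 (`|U w 0 i| - `|V w 0 i|); nra.
Qed.

Let dotvE w : (dotv (U w) (V w))%:E = (\sum_(i < n) (U w 0 i * V w 0 i)%:E)%E.
Proof. by rewrite sumEFin. Qed.

Let integrable_dotv : P.-integrable setT (fun w => (dotv (U w) (V w))%:E).
Proof. by under eq_fun do rewrite dotvE; exact: integrable_sum. Qed.

Let integral_dotv0 : (\int[P]_w (dotv (U w) (V w))%:E = 0)%E.
Proof.
under eq_integral do rewrite dotvE.
rewrite integral_sum// big1// => i _.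
apply: (@integral_mul_comp0 _ _ _ P _ (measurableTypeR R) idfun
  (fun w => U w 0 i) (fun w => V w 0 i)) => //.
- exact: measurable_id.
- exact: mU.
- exact: iVi.
- exact: iUV.
- exact: V_orth.
Qed.

(** Pythagoras in L^2: the cross term splits into coordinates, and each U_i V_i has mean 0 since V_i
    is centred given U_i. *)
Lemma integral_sqn_orthogonal (c : R) :
  (\int[P]_w (sqn (U w + c *: V w))%:E
   = \int[P]_w (sqn (U w))%:E + (c ^+ 2)%:E * \int[P]_w (sqn (V w))%:E)%E.
Proof.
under eq_integral do rewrite sqnDZ !EFinD !EFinM.
have iD : P.-integrable setT (fun w => (2%:E * c%:E * (dotv (U w) (V w))%:E)%E).
  by rewrite -EFinM; exact: integrableZl.
have iV2 : P.-integrable setT (fun w => ((c ^+ 2)%:E * (sqn (V w))%:E)%E).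
  exact: integrableZl.
rewrite integralD//; last exact: integrableD.
rewrite integralD// -EFinM !integralZl//.
by rewrite integral_dotv0 mule0 adde0.
Qed.
End second_moments.

(** * The one-step recursion for the expected Lyapunov function *)

Lemma integral_affine (d : measure_display) (T : measurableType d)
    (R : realType) (P : probability T R) (u v : T -> R) (a b A B C : R) :
  P.-integrable setT (fun w => (u w)%:E) ->
  P.-integrable setT (fun w => (v w)%:E) ->
  (\int[P]_w (u w)%:E = a%:E)%E -> (\int[P]_w (v w)%:E = b%:E)%E ->
  (\int[P]_w (A * u w + B * v w + C)%:E = (A * a + B * b + C)%:E)%E.
Proof.
move=> iu iv ua vb.
have iAu : P.-integrable setT (fun w => (A%:E * (u w)%:E)%E) by exact: integrableZl.
have iBv : P.-integrable setT (fun w => (B%:E * (v w)%:E)%E) by exact: integrableZl.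
have iC : P.-integrable setT (EFin \o cst C) by exact: finite_measure_integrable_cst.
under eq_integral do rewrite !EFinD !EFinM.
rewrite integralD//; last exact: integrableD.
rewrite integralD// !integralZl// ua vb integral_cst//= probability_setT mule1.
by rewrite -!EFinM -!EFinD.
Qed.

(** Here a, s stand for the expectations of |x_k - xstar|^2 and sigma_k^2, and a', s' for those at k
    + 1. Inserting the bound on a' into (1 + alpha A2) a' + alpha B2 s + alpha C2 leaves the two
    entries of the maximum as coefficients of a and of alpha s. *)
Lemma lyapunov_step (R : realType) (a a' s s' A1 B1 C1 A2 B2 C2 gam mu alpha : R) :
  0 < gam -> 0 < mu -> 0 < alpha -> 0 <= A2 -> 0 <= a -> 0 <= s ->
  (1 + gam * mu) ^+ 2 * a' <= a + gam ^+ 2 * (A1 * a + B1 * s + C1) ->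
  s' <= A2 * a' + B2 * s + C2 ->
  a' + alpha * s' <=
    Num.max ((1 + gam ^+ 2 * A1) * (1 + alpha * A2) / (1 + gam * mu) ^+ 2)
      (gam ^+ 2 * B1 * (1 + alpha * A2) / (alpha * (1 + gam * mu) ^+ 2) + B2)
      * (a + alpha * s)
    + (gam ^+ 2 * C1 * (1 + alpha * A2) / (1 + gam * mu) ^+ 2 + alpha * C2).
Proof.
move=> gam0 mu0 alpha0 A20 a0 s0.
have : 0 < (1 + gam * mu) ^+ 2 by rewrite exprn_gt0// addr_gt0 ?mulr_gt0.
move: ((1 + gam * mu) ^+ 2) => q q0 a'_le s'_le.
set t1 := _ / q; set t2 := _ + B2; set th := Num.max _ _.
have t1_le : t1 <= th by rewrite /th le_max lexx.
have t2_le : t2 <= th by rewrite /th le_max lexx orbT.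
have b0 : 0 <= 1 + alpha * A2 by rewrite addr_ge0 ?mulr_ge0// ltW.
have {}a'_le : a' <= (a + gam ^+ 2 * (A1 * a + B1 * s + C1)) / q.
  by rewrite ler_pdivlMr// mulrC.
have h1 := ler_wpM2l (ltW alpha0) s'_le.
have h2 := ler_wpM2l b0 a'_le.
have h3 := ler_wpM2r a0 t1_le.
have h4 := ler_wpM2r (mulr_ge0 (ltW alpha0) s0) t2_le.
have -> : th * (a + alpha * s) = th * a + th * (alpha * s) by ring.
have e : (1 + alpha * A2) * ((a + gam ^+ 2 * (A1 * a + B1 * s + C1)) / q)
  + alpha * B2 * s + alpha * C2 = t1 * a + t2 * (alpha * s)
    + (gam ^+ 2 * C1 * (1 + alpha * A2) / q + alpha * C2).
  by rewrite /t1 /t2; field; rewrite !gt_eqF.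
lra.
Qed.

(** * Linear convergence of SPPM-LC up to a neighbourhood *)

Unset Implicit Arguments.
Set Strict Implicit.

Theorem theorem1
  (R : realType) (d m : nat)
  (dO : measure_display) (Omega : measurableType dO) (P : probability Omega R)
  (dX : measure_display) (Xi : measurableType dX) (D : probability Xi R)
  (f : Xi -> 'rV[R]_d -> R) (mu : R) (xstar : 'rV[R]_d)
  (sigma2 : 'rV[R]_m -> R)
  (A1 B1 C1 A2 B2 C2 gam alpha : R)
  (x0 : 'rV[R]_d) (phi0 : 'rV[R]_m)
  (x : nat -> Omega -> 'rV[R]_d) (phi : nat -> Omega -> 'rV[R]_m)
  (xi : nat -> Omega -> Xi) (h : nat -> Omega -> 'rV[R]_d)
  (H : nat -> 'rV[R]_d -> 'rV[R]_m -> Xi -> 'rV[R]_d) :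
  (* each f_xi is differentiable and mu-strongly convex, mu > 0 *)
  0 < mu ->
  (forall z y, differentiable (f z) y) ->
  (forall z u y, f z y + dotv (grad (f z) y) (u - y) + mu / 2 * sqn (u - y)
                 <= f z u) ->
  (* f = E_{xi ~ D}[f_xi] is well defined, and differentiation and
     expectation can be interchanged *)
  (forall y, D.-integrable setT (fun z => (f z y)%:E)) ->
  (forall y (i : 'I_d), D.-integrable setT (fun z => (grad (f z) y 0 i)%:E)) ->
  (forall y, differentiable (fun u => Rintegral D setT (fun z => f z u)) y /\
     grad (fun u => Rintegral D setT (fun z => f z u)) y
       = \row_(i < d) Rintegral D setT (fun z => grad (f z) y 0 i)) ->
  (* xstar is the unique minimizer of f *)
  (forall y, Rintegral D setT (fun z => f z xstar)
             <= Rintegral D setT (fun z => f z y)) ->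
  (forall y, (forall u, Rintegral D setT (fun z => f z y)
                        <= Rintegral D setT (fun z => f z u)) -> y = xstar) ->
  (* SPPM-LC *)
  0 < gam ->
  (forall w, x 0%N w = x0) -> (forall w, phi 0%N w = phi0) ->
  (forall k, vec_measurable (x k)) -> (forall k, vec_measurable (phi k)) ->
  (forall k, vec_measurable (h k)) -> (forall k, measurable_fun setT (xi k)) ->
  (forall k, measurable_fun setT (fun w => sigma2 (phi k w))) ->
  (forall k A, measurable A -> P (xi k @^-1` A) = D A) ->
  (forall k A E, measurable A -> <<s past_events x phi xi k >> E ->
     P (xi k @^-1` A `&` E) = (P (xi k @^-1` A) * P E)%E) ->
  (forall k w, h k w = H k (x k w) (phi k w) (xi k w)) ->
  (forall k w, is_prox gam (f (xi k w)) (x k w + gam *: h k w) (x k.+1 w)) ->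
  (* sigma_k^2-assumption *)
  (forall v, 0 <= sigma2 v) ->
  0 <= A1 -> 0 <= B1 -> 0 <= C1 -> 0 <= A2 -> 0 <= B2 -> 0 <= C2 -> B2 < 1 ->
  (* (i)  E[h_k | x_k, phi_k] = 0 *)
  (forall k (i : 'I_d), P.-integrable setT (fun w => (h k w 0 i)%:E) /\
     forall E, <<s vec_events (x k) `|` vec_events (phi k) >> E ->
       (\int[P]_(w in E) (h k w 0 i)%:E = 0)%E) ->
  (* (ii) E[||h_k - grad f_{xi_k}(xstar)||^2 | x_k, phi_k]
            <= A1 ||x_k - xstar||^2 + B1 sigma_k^2 + C1 *)
  (forall k E, <<s vec_events (x k) `|` vec_events (phi k) >> E ->
     (\int[P]_(w in E) (sqn (h k w - grad (f (xi k w)) xstar))%:E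
      <= \int[P]_(w in E)
           (A1 * sqn (x k w - xstar) + B1 * sigma2 (phi k w) + C1)%:E)%E) ->
  (* (iii) E[sigma_{k+1}^2 | x_{k+1}, phi_k]
            <= A2 ||x_{k+1} - xstar||^2 + B2 sigma_k^2 + C2 *)
  (forall k E, <<s vec_events (x k.+1) `|` vec_events (phi k) >> E ->
     (\int[P]_(w in E) (sigma2 (phi k.+1 w))%:E
      <= \int[P]_(w in E)
           (A2 * sqn (x k.+1 w - xstar) + B2 * sigma2 (phi k w) + C2)%:E)%E) ->
  (* step-size conditions *)
  0 < alpha ->
  (1 + gam ^+ 2 * A1) * (1 + alpha * A2) / (1 + gam * mu) ^+ 2 < 1 ->
  gam ^+ 2 * B1 * (1 + alpha * A2) / (alpha * (1 + gam * mu) ^+ 2) + B2 < 1 ->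
  let theta := Num.max
      ((1 + gam ^+ 2 * A1) * (1 + alpha * A2) / (1 + gam * mu) ^+ 2)
      (gam ^+ 2 * B1 * (1 + alpha * A2) / (alpha * (1 + gam * mu) ^+ 2) + B2) in
  let zeta := gam ^+ 2 * C1 * (1 + alpha * A2) / (1 + gam * mu) ^+ 2
              + alpha * C2 in
  let Psi := fun k w => sqn (x k w - xstar) + alpha * sigma2 (phi k w) in
  [/\ 0 <= theta < 1, 0 <= zeta &
   forall k, (\int[P]_w (Psi k w)%:E
              <= (theta ^+ k * (sqn (x0 - xstar) + alpha * sigma2 phi0)
                  + zeta / (1 - theta))%:E)%E].
Proof.
move=> mu_gt0 _ f_convex _ g_int F_diff F_min _ gam_gt0 x0E phi0E
  mx mphi mh mxi msigma law_xi indep_xi _ prox_x sigma_ge0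
  A1_ge0 B1_ge0 C1_ge0 A2_ge0 B2_ge0 C2_ge0 B2_lt1 h_mean h_var sigma_rec
  alpha_gt0 t1_lt1 t2_lt1 theta zeta Psi.
have q_gt0 : 0 < (1 + gam * mu) ^+ 2.
  by rewrite exprn_gt0// addr_gt0 ?mulr_gt0.
have gam2_ge0 : 0 <= gam ^+ 2 by exact: sqr_ge0.
have gam_ge0 := ltW gam_gt0; have mu_ge0 := ltW mu_gt0.
have alpha_ge0 := ltW alpha_gt0.
have theta_ge0 : 0 <= theta.
  rewrite /theta le_max; apply/orP; left.
  by rewrite divr_ge0 ?mulr_ge0 ?addr_ge0 ?mulr_ge0.
have theta_lt1 : theta < 1 by rewrite /theta gt_max t1_lt1.
have zeta_ge0 : 0 <= zeta.
  by rewrite /zeta addr_ge0 ?divr_ge0 ?mulr_ge0 ?addr_ge0 ?mulr_ge0.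
split=> //; first by rewrite theta_ge0.
pose gs z := grad (f z) xstar.
(* By the interchange hypothesis this mean is a coordinate of the gradient of f at its minimizer.
   Integrability lifts the equality from [Rintegral], a real number, back to the extended
   integral. *)
have gs_mean i : (\int[D]_z (gs z 0 i)%:E = 0)%E.
  have [_ gradF] := F_diff xstar.
  have := grad_at_min (fun y => (F_diff y).1) F_min.
  rewrite gradF => /rowP/(_ i); rewrite !mxE /Rintegral => g0.
  by rewrite -[LHS]fineK ?g0//; exact: integrable_fin_num (g_int xstar i).
have mxs k : vec_measurable (fun w => x k w - xstar).
  move=> i; under eq_fun do rewrite !mxE.
  by apply: measurable_funB => //; exact: mx.
have igs k i : P.-integrable setT (fun w => (gs (xi k w) 0 i)%:E).
  exact: (integrable_law (mxi k) (law_xi k) (g_int xstar i)).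
have hgE k w i :
    (h k w - gs (xi k w)) 0 i = h k w 0 i - gs (xi k w) 0 i.
  by rewrite mxE [X in _ + X]mxE.
have mhg k : vec_measurable (fun w => h k w - gs (xi k w)).
  move=> i; under eq_fun do rewrite hgE.
  apply: measurable_funB; first exact: mh.
  exact/measurable_EFinP/(measurable_int _ (igs k i)).
have ihg k i : P.-integrable setT (fun w => ((h k w - gs (xi k w)) 0 i)%:E).
  under eq_fun do rewrite hgE EFinB.
  exact: (integrableB measurableT (h_mean k i).1 (igs k i)).
(* An event E of x_k belongs both to the sigma-algebra on which h_k is centred and to the past of
   xi_k, so the integral of [gs (xi k w)] over E is P E times its mean 0. *)
have hg_orth k (i j : 'I_d) (A : set R) : measurable A ->
    (\int[P]_(w in (fun w => ((x k w - xstar) 0 i)%R) @^-1` A)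
      ((h k w - gs (xi k w)) 0 j)%:E = 0)%E.
  move=> mA; set E := _ @^-1` A.
  have mE : measurable E by rewrite -[E]setTI; exact: mxs.
  (* Subtracting [xstar] only translates the Borel set A. *)
  have xE : vec_events (x k) E.
    exists i, ((fun r => r - xstar 0 i) @^-1` A); split.
      rewrite -[X in measurable X]setTI.
      by apply: (measurable_funB (@measurable_id _ _ setT)).
    by apply/seteqP; split=> w; rewrite /E /= !mxE.
  under eq_integral do rewrite hgE EFinB.
  rewrite integralB//; last 2 first.
  - apply: (integrableS measurableT mE) => //; exact: (h_mean k j).1.
  - by apply: (integrableS measurableT mE) => //; exact: igs.
  have sE : <<s vec_events (x k) `|` vec_events (phi k) >> E.
    by apply: sub_sigma_algebra; left.
  rewrite ((h_mean k j).2 _ sE).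
  rewrite (integral_independent (mxi k) (law_xi k) (g_int xstar j))//.
    by rewrite gs_mean mule0 sube0.
  move=> B mB; apply: indep_xi => //; apply: sub_sigma_algebra; left.
  by exists k; split=> //; left.
(* With the whole space as event, the conditional bounds become bounds on full expectations. *)
have sigmaT (G : set (set Omega)) : <<s G >> setT.
  by have := sigma_algebraCD (@sigma_algebra0 _ setT G); rewrite setD0.
(* The contraction is used at q = xstar and y = x_k + gam h_k. *)
have contract k w : (1 + gam * mu) ^+ 2 * sqn (x k.+1 w - xstar)
    <= sqn (x k w - xstar + gam *: (h k w - gs (xi k w))).
  have := prox_contraction (g := grad (f (xi k w))) gam_gt0
    (f_convex (xi k w)) xstar mu_gt0 (prox_x k w).
  congr (_ <= sqn _); apply/rowP => i; rewrite !mxE; ring.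
(* Asking for real values a and s makes the induction carry finiteness of both moments along with
   the bound. *)
suff moments k : exists a s : R, [/\ (\int[P]_w (sqn (x k w - xstar))%:E = a%:E)%E,
    (\int[P]_w (sigma2 (phi k w))%:E = s%:E)%E &
    a + alpha * s <= theta ^+ k * (sqn (x0 - xstar) + alpha * sigma2 phi0)
                  + zeta / (1 - theta)].
  move=> k; have [a [s [aE sE as_le]]] := moments k.
  under eq_integral do rewrite EFinD EFinM.
  rewrite ge0_integralD//; last 4 first.
  - by move=> w _; rewrite lee_fin sqn_ge0.
  - by apply/measurable_EFinP; exact: measurable_sqn.
  - by move=> w _; rewrite -EFinM lee_fin mulr_ge0// ltW.
  - by apply/measurable_EFinP; apply: measurable_funM.
  rewrite ge0_integralZl ?lee_fin ?(ltW alpha_gt0)//; last 2 first.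
  - exact/measurable_EFinP.
  - by move=> w _; rewrite lee_fin.
  by rewrite aE sE -EFinM -EFinD lee_fin.
elim: k => [|k [a [s [aE sE IH]]]].
  exists (sqn (x0 - xstar)), (sigma2 phi0); split.
  - under eq_integral do rewrite x0E.
    by rewrite integral_cst//= probability_setT mule1.
  - under eq_integral do rewrite phi0E.
    by rewrite integral_cst//= probability_setT mule1.
  by rewrite expr0 mul1r lerDl divr_ge0// subr_ge0 ltW.
have a_ge0 : 0 <= a.
  by rewrite -lee_fin -aE integral_ge0// => w _; rewrite lee_fin sqn_ge0.
have s_ge0 : 0 <= s.
  by rewrite -lee_fin -sE integral_ge0// => w _; rewrite lee_fin.
have ix : P.-integrable setT (fun w => (sqn (x k w - xstar))%:E).
  apply: ge0_integrable_lty; rewrite ?aE ?ltry//; first exact: measurable_sqn.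
  by move=> w; exact: sqn_ge0.
have is2 : P.-integrable setT (fun w => (sigma2 (phi k w))%:E).
  by apply: ge0_integrable_lty; rewrite ?sE ?ltry.
have var_le : (\int[P]_w (sqn (h k w - gs (xi k w)))%:E
    <= (A1 * a + B1 * s + C1)%:E)%E.
  by rewrite -(integral_affine _ _ _ ix is2 aE sE); exact: h_var.
have ihg2 : P.-integrable setT (fun w => (sqn (h k w - gs (xi k w)))%:E).
  apply: ge0_integrable_lty; first exact: measurable_sqn.
    by move=> w; exact: sqn_ge0.
  by apply: le_lt_trans var_le _; rewrite ltry.
(* Stated in the extended reals: finiteness of the moment at k + 1 is deduced from this very
   inequality. *)
have step_le : (((1 + gam * mu) ^+ 2)%:E * \int[P]_w (sqn (x k.+1 w - xstar))%:E
    <= (a + gam ^+ 2 * (A1 * a + B1 * s + C1))%:E)%E.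
  apply: (@le_trans _ _ (\int[P]_w
      (sqn (x k w - xstar + gam *: (h k w - gs (xi k w))))%:E)%E).
    rewrite -ge0_integralZl ?lee_fin ?(ltW q_gt0)//; last 2 first.
    - by apply/measurable_EFinP; exact: measurable_sqn.
    - by move=> w _; rewrite lee_fin sqn_ge0.
    apply: ge0_le_integral => //.
    - by move=> w _; rewrite -EFinM lee_fin mulr_ge0 ?sqn_ge0// ltW.
    - by apply/measurable_EFinP; apply: measurable_funM => //; exact: measurable_sqn.
    - apply/measurable_EFinP; apply: measurable_sqn => i.
      have entryE w : (x k w - xstar + gam *: (h k w - gs (xi k w))) 0 i
        = (x k w - xstar) 0 i + gam * (h k w - gs (xi k w)) 0 i.
        by rewrite mxE [X in _ + X]mxE.
      under eq_fun do rewrite entryE.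
      apply: measurable_funD; first exact: mxs.
      by apply: measurable_funM => //; exact: mhg.
    - by move=> w _; rewrite -EFinM lee_fin.
  (* The cross term disappears here, leaving a plus gam^2 times the noise variance. *)
  rewrite (integral_sqn_orthogonal (mxs k) (mhg k) ix ihg2 (ihg k)); last first.
    by move=> i A; exact: hg_orth.
  by rewrite aE EFinD leeD2l// [leRHS]EFinM lee_wpmul2l ?lee_fin.
have a'_lty : (\int[P]_w (sqn (x k.+1 w - xstar))%:E < +oo)%E.
  rewrite -(@lte_pmul2l _ ((1 + gam * mu) ^+ 2)%:E) ?lte_fin//.
  by rewrite gt0_muley ?lte_fin//; apply: le_lt_trans step_le _; rewrite ltry.
have ix' : P.-integrable setT (fun w => (sqn (x k.+1 w - xstar))%:E).
  apply: ge0_integrable_lty => //; first exact: measurable_sqn.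
  by move=> w; exact: sqn_ge0.
have a'E := fineK (integrable_fin_num measurableT ix').
set a' := fine _ in a'E.
(* Integrating the bound on sigma_{k+1}^2 comes only now, since it involves a', whose finiteness has
   just been shown. *)
have s'_le : (\int[P]_w (sigma2 (phi k.+1 w))%:E
    <= (A2 * a' + B2 * s + C2)%:E)%E.
  by rewrite -(integral_affine _ _ _ ix' is2 (esym a'E) sE); exact: sigma_rec.
have is2' : P.-integrable setT (fun w => (sigma2 (phi k.+1 w))%:E).
  by apply: ge0_integrable_lty => //; apply: le_lt_trans s'_le _; rewrite ltry.
have s'E := fineK (integrable_fin_num measurableT is2').
set s' := fine _ in s'E.
exists a', s'; split=> //.
rewrite -s'E lee_fin in s'_le.
rewrite -a'E -EFinM lee_fin in step_le.
apply: le_trans (lyapunov_step gam_gt0 mu_gt0 alpha_gt0 A2_ge0 a_ge0 s_ge0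
  step_le s'_le) _.
rewrite -/theta -/zeta exprS -mulrA.
apply: (le_trans (lerD (ler_wpM2l theta_ge0 IH) (lexx zeta))).
rewrite mulrDr -addrA lerD2l.
(* zeta / (1 - theta) is the fixed point of r -> theta r + zeta. *)
suff -> : theta * (zeta / (1 - theta)) + zeta = zeta / (1 - theta) by [].
by field; rewrite subr_eq0 eq_sym lt_eqF.
Qed.
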